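(* Let $\mathcal M=(M,<,\ldots)$ be a locally o-minimal structure. Then at least one of the following holds: (1) $\mathcal M$ does not have the univariate $*$-continuity property and there is a dimensionally wild definable set; (2) for every open interval $I$ and every definable function $f:I\to\overline M$, $I$ can be decomposed into four definable sets $X_+,X_-,X_c,X_d$ such that (i) $X_d$ is discrete and closed; (ii) $X_c$ is open and $f|_{X_c}$ is locally constant; (iii) $X_-$ is open and $f|_{X_-}$ is locally strictly decreasing; (iv) $X_+$ is open and $f|_{X_+}$ is locally strictly increasing.
   Context: $\mathcal M$ is an expansion of a dense linear order without endpoints; ''definable'' means with parameters; order topology. Locally o-minimal: for every definable $X\subseteq M$ and $a\in M$ there is an open interval $I\ni a$ with $X\cap I$ a union of a finite set and finitely many open intervals. $\overline M$ (definable Dedekind completion) is $M$ together with all definable gaps $(A,B)$ (nonempty definable $A,B$, $M=A\cup B$, $A<B$, $A$ without maximum, $B$ without minimum), with the natural order. A definable function $F:X\to\overline M$ on definable $X\subseteq M^k$ is one with $F(x)=\sup Y_x$ for a definable $Y\subseteq M^{k+1}$ projecting onto $X$, where $Y_x=\{y:(x,y)\in Y\}$. Univariate $*$-continuity property: for every definable $f:I\to\overline M$ on a nonempty open interval $I$ there is a nonempty open subinterval $J\subseteq I$ on which $f$ is continuous ($\overline M$ with its order topology). A definable $X\subseteq M^2$ is dimensionally wild if $X$ has empty interior, the projection $\pi(X)$ onto the first coordinate has nonempty interior, and $X_x=\{y:(x,y)\in X\}$ has nonempty interior for every $x\in\pi(X)$. A function on an open subset of $M$ is locally constant (resp. locally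 strictly increasing/decreasing) if each point has an open interval neighbourhood in the domain on which it is constant (resp. strictly increasing/decreasing). *)

(* Defs.v *)
From HB Require Import structures.
From mathcomp Require Import all_boot all_order interval.
From mathcomp Require Import all_classical topology.

Set Implicit Arguments.
Unset Strict Implicit.
Unset Printing Implicit Defensive.

Import Order.TTheory.

Local Open Scope order_scope.
Local Open Scope classical_set_scope.

(* The symbols of the language other than [=] and [<], which are built into
   the formulas. *)
Record language := Language {
  fun_symb : Type;
  fun_arity : fun_symb -> nat;
  rel_symb : Type;
  rel_arity : rel_symb -> nat
}.

Record structure (L : language) (M : Type) := Structure {
  fun_interp : forall s : fun_symb L, ('I_(fun_arity s) -> M) -> M;
  rel_interp : forall s : rel_symb L, ('I_(rel_arity s) -> M) -> Prop
}.

(* Terms and formulas with free variables in [V] and with the elements of [M]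
   as additional constants, i.e. as parameters. A quantifier binds the
   variable [None] of [option V]. *)
Inductive term (L : language) (M V : Type) : Type :=
| Var of V
| Par of M
| App (s : fun_symb L) of ('I_(fun_arity s) -> term L M V).

Inductive formula (L : language) (M : Type) (V : Type) : Type :=
| FEq of term L M V & term L M V
| FLt of term L M V & term L M V
| FRel (s : rel_symb L) of ('I_(rel_arity s) -> term L M V)
| FNot of formula L M V
| FAnd of formula L M V & formula L M V
| FEx of formula L M (option V).

Section Semantics.
Context {d : Order.disp_t} {M : orderType d} {L : language}.
Variable S : structure L M.

Fixpoint eval (V : Type) (v : V -> M) (t : term L M V) : M :=
  match t with
  | Var i => v i
  | Par a => a
  | App s args => fun_interp S (fun k => eval v (args k))
  end.

Definition extend (V : Type) (v : V -> M) (a : M) : option V -> M :=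
  fun i => if i is Some j then v j else a.

Fixpoint sat (V : Type) (v : V -> M) (phi : formula L M V) : Prop :=
  match phi with
  | FEq t u => eval v t = eval v u
  | FLt t u => eval v t < eval v u
  | FRel s args => rel_interp S (fun k => eval v (args k))
  | FNot psi => ~ sat v psi
  | FAnd psi chi => sat v psi /\ sat v chi
  | FEx psi => exists a, sat (extend v a) psi
  end.

Definition definable (n : nat) (X : set ('I_n -> M)) : Prop :=
  exists phi : formula L M 'I_n, X = [set v | sat v phi].

Definition definable1 (X : set M) : Prop :=
  definable [set v : 'I_1 -> M | X (v ord0)].

Definition definable2 (X : set (M * M)) : Prop :=
  definable [set v : 'I_2 -> M | X (v ord0, v ord_max)].

End Semantics.

Definition dlo_without_endpoints d (M : orderType d) : Prop :=
  [/\ (exists x : M, True),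
      (forall x y : M, x < y -> exists z, x < z < y),
      (forall x : M, exists y, y < x) &
      (forall x : M, exists y, x < y)].

Section Completion.
Context {d : Order.disp_t} {M : orderType d} {L : language}.
Variable S : structure L M.

Record gap := Gap {
  gap_lower : set M;
  gap_upper : set M;
  gap_lower_definable : definable1 S gap_lower;
  gap_upper_definable : definable1 S gap_upper;
  gap_lower_nonempty : gap_lower !=set0;
  gap_upper_nonempty : gap_upper !=set0;
  gap_cover : gap_lower `|` gap_upper = setT;
  gap_lt : forall a b, gap_lower a -> gap_upper b -> a < b;
  gap_lower_nomax : forall a, gap_lower a -> exists2 a', gap_lower a' & a < a';
  gap_upper_nomin : forall b, gap_upper b -> exists2 b', gap_upper b' & b' < b
}.

Lemma gap_upperE (g : gap) : gap_upper g = ~` gap_lower g.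
Proof.
apply/seteqP; split => x /=.
  by move=> ux lx; have := gap_lt lx ux; rewrite ltxx.
by move=> nlx; have : setT x by []; rewrite -(gap_cover g) => -[].
Qed.

Lemma gap_lower_down (g : gap) x y : x <= y -> gap_lower g y -> gap_lower g x.
Proof.
move=> xy ly; apply: contrapT => nlx.
have ux : gap_upper g x by rewrite gap_upperE.
by have := gap_lt ly ux; rewrite ltNge xy.
Qed.

Lemma gap_eq (g h : gap) : gap_lower g = gap_lower h -> g = h.
Proof.
move=> e; have := gap_upperE h; rewrite -e -gap_upperE.
case: g e => A B p1 p2 p3 p4 p5 p6 p7 p8.
case: h => A' B' q1 q2 q3 q4 q5 q6 q7 q8 /= eA eB.
by subst A' B'; f_equal; exact: Prop_irrelevance.
Qed.

Inductive completion : Type :=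
| Elt of M
| GapPt of gap.

HB.instance Definition _ := gen_eqMixin completion.
HB.instance Definition _ := gen_choiceMixin completion.

Definition completion_le (p q : completion) : bool :=
  match p, q with
  | Elt a, Elt b => a <= b
  | Elt a, GapPt g => `[< gap_lower g a >]
  | GapPt g, Elt b => `[< gap_upper g b >]
  | GapPt g, GapPt h => `[< gap_lower g `<=` gap_lower h >]
  end.

Lemma completion_le_refl : reflexive completion_le.
Proof. by case=> [a|g] /=; [exact: lexx | exact/asboolP]. Qed.

Lemma completion_le_anti : antisymmetric completion_le.
Proof.
case=> [a|g] [b|h] /= /andP[].
- by move=> ab ba; congr Elt; apply/le_anti/andP.
- by move=> /asboolP la /asboolP; rewrite gap_upperE.
- by move=> /asboolP + /asboolP lb; rewrite gap_upperE.
- move=> /asboolP gh /asboolP hg; congr GapPt; apply: gap_eq.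
  by apply/seteqP.
Qed.

Lemma completion_le_trans : transitive completion_le.
Proof.
case=> [b|h] [a|g] [c|k] /=.
- exact: le_trans.
- by move=> ab /asboolP lb; apply/asboolP/(gap_lower_down ab).
- move=> /asboolP + bc; rewrite !gap_upperE => ngb; apply/asboolP => gc.
  by apply/ngb/(gap_lower_down bc).
- move=> /asboolP; rewrite gap_upperE => ngb /asboolP kb; apply/asboolP => x gx.
  have /orP[xb|bx] := le_total x b; first exact: gap_lower_down xb kb.
  by case: ngb; exact: gap_lower_down bx gx.
- move=> /asboolP ha /asboolP; rewrite gap_upperE => nhc.
  have /orP[//|ca] := le_total a c.
  by case: nhc; exact: gap_lower_down ca ha.
- by move=> /asboolP ha /asboolP hk; apply/asboolP/hk.
- move=> /asboolP gh /asboolP; rewrite !gap_upperE => nhc; apply/asboolP.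
  by move=> /gh.
- by move=> /asboolP gh /asboolP hk; apply/asboolP => x /gh/hk.
Qed.

Lemma completion_le_total : total completion_le.
Proof.
case=> [a|g] [b|h] /=.
- exact: le_total.
- by rewrite gap_upperE -asbool_or; apply/asboolP; exact: EM.
- by rewrite gap_upperE orbC -asbool_or; apply/asboolP; exact: EM.
- rewrite -asbool_or; apply/asboolP.
  have [gh|/existsNP[x /not_implyP[gx nhx]]] :=
    pselect (gap_lower g `<=` gap_lower h); first by left.
  right => y hy; have /orP[yx|xy] := le_total y x.
    exact: gap_lower_down yx gx.
  by case: nhx; exact: gap_lower_down xy hy.
Qed.

HB.instance Definition _ := Order.Le_isPOrder.Build d completion
  completion_le_refl completion_le_anti completion_le_trans.
HB.instance Definition _ :=
  Order.POrder_isTotal.Build d completion completion_le_total.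
HB.instance Definition _ :=
  OrderTopological.copy completion (order_topology completion).

(* [f] is only relevant on [X]. The supremum is the one of [completion], so the
   sections of [Y] are bounded above over [X]. *)
Definition definable_fun (X : set M) (f : M -> completion) : Prop :=
  definable1 S X /\
  exists Y : set (M * M), [/\ definable2 S Y,
    fst @` Y = X &
    forall x, X x -> supremums (Elt @` [set y | Y (x, y)]) (f x)].

End Completion.

Section Tameness.
Context {d : Order.disp_t} {M : orderTopologicalType d} {L : language}.
Variable S : structure L M.

(* Throughout, [itv_open_ends i] says that [i] has its endpoints in
   M u {-oo, +oo} and does not contain them. *)
Definition locally_o_minimal : Prop :=
  forall (X : set M) (a : M), definable1 S X ->
  exists i : interval M, [/\ itv_open_ends i, a \in i &
    exists (F : set M) (s : seq (interval M)),
      [/\ finite_set F, all itv_open_ends s &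
          X `&` [set` i] = F `|` \big[setU/set0]_(j <- s) [set` j]]].

Definition univariate_star_continuity : Prop :=
  forall (i : interval M) (f : M -> completion S),
    itv_open_ends i -> [set` i] !=set0 -> definable_fun [set` i] f ->
  exists j : interval M,
    [/\ itv_open_ends j, [set` j] !=set0, [set` j] `<=` [set` i] &
        {within [set` j], continuous f}].

Definition dimensionally_wild (X : set (M * M)) : Prop :=
  [/\ interior X = set0,
      interior (fst @` X) !=set0 &
      forall x, (fst @` X) x -> interior [set y | X (x, y)] !=set0].

Definition discrete (X : set M) : Prop := X `<=` isolated X.

Definition locally_on (P : set M -> Prop) (X : set M) : Prop :=
  forall x, X x -> exists i : interval M,
    [/\ itv_open_ends i, x \in i, [set` i] `<=` X & P [set` i]].

Definition constant_on (f : M -> completion S) (A : set M) : Prop :=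
  forall x y, A x -> A y -> f x = f y.

Definition increasing_on (f : M -> completion S) (A : set M) : Prop :=
  forall x y, A x -> A y -> x < y -> f x < f y.

Definition decreasing_on (f : M -> completion S) (A : set M) : Prop :=
  forall x y, A x -> A y -> x < y -> f y < f x.

Definition locally_monotone_decomposition (I : set M) (f : M -> completion S)
    (Xp Xm Xc Xd : set M) : Prop :=
  [/\ [/\ definable1 S Xp, definable1 S Xm, definable1 S Xc & definable1 S Xd],
      Xp `|` Xm `|` Xc `|` Xd = I,
      [/\ Xp `&` Xm = set0, Xp `&` Xc = set0 & Xp `&` Xd = set0] /\
      [/\ Xm `&` Xc = set0, Xm `&` Xd = set0 & Xc `&` Xd = set0] &
      [/\ discrete Xd /\ closed Xd,
          open Xc /\ locally_on (constant_on f) Xc,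
          open Xm /\ locally_on (decreasing_on f) Xm &
          open Xp /\ locally_on (increasing_on f) Xp]].

End Tameness.

(* Main.v *)
(* The key is a Ramsey principle: for a definable T in M^2, every open interval
   contains an open interval on which either T(x, y) for all x < y, or ~ T(x, y)
   for all x < y. By local o-minimality every x has a right germ inside T_x or
   inside its complement, and on a subinterval the same alternative holds for
   all x, say the first. Let D be the set of the (x, y) such that x < y and
   ]x, y] is contained in T_x. If D contains an open box U x V, then T(x, y)
   holds for x < y in U small. Otherwise D is dimensionally wild, so that
   *-continuity may be assumed; then beta(x) = sup D_x > x is continuous at some
   x0, and an element c with x0 < c < beta(x0) stays below beta near x0, where
   T(x, y) thus holds for x < y < c.

   Applied to f(x) < f(y), f(x) > f(y) and f(x) = f(y), this gives on every
   interval a subinterval where f is strictly monotone or constant. So the set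
   of the points around which f is neither has empty interior, and by local
   o-minimality it is locally finite, i.e. discrete and closed. *)
Require Import Defs.
From HB Require Import structures.
From mathcomp Require Import all_boot all_order interval.
From mathcomp Require Import all_classical topology.

Set Implicit Arguments.
Unset Strict Implicit.
Unset Printing Implicit Defensive.

Import Order.TTheory.

Local Open Scope order_scope.
Local Open Scope classical_set_scope.

(** * Definable predicates and their closure properties *)

Section Definability.
Context {d : Order.disp_t} {M : orderType d} {L : language}.
Context (S : structure L M).

(** Any type of variables is allowed, so that going under a quantifier only replaces [V] by
    [option V]. *)
Definition definable_pred (V : Type) (P : (V -> M) -> Prop) : Prop :=
  exists phi : formula L M V, forall v, P v <-> sat S v phi.

Fixpoint rename_term (V W : Type) (r : V -> W) (t : term L M V) :
    term L M W :=
  match t with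
  | Var i => Var L M (r i)
  | Par a => Par L W a
  | App s args => App (fun k => rename_term r (args k))
  end.

Fixpoint rename (V W : Type) (r : V -> W) (phi : formula L M V) :
    formula L M W :=
  match phi with
  | FEq t u => FEq (rename_term r t) (rename_term r u)
  | FLt t u => FLt (rename_term r t) (rename_term r u)
  | FRel s args => FRel (fun k => rename_term r (args k))
  | FNot psi => FNot (rename r psi)
  | FAnd psi chi => FAnd (rename r psi) (rename r chi)
  | FEx psi => FEx (rename (omap r) psi)
  end.

Lemma eval_rename (V W : Type) (r : V -> W) (v : W -> M) (t : term L M V) :
  Defs.eval S v (rename_term r t) = Defs.eval S (v \o r) t.
Proof.
by elim: t => //= s args IH; congr fun_interp; apply/funext => k; exact: IH.
Qed.

Lemma sat_rename (V W : Type) (r : V -> W) (v : W -> M) (phi : formula L M V) :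
  sat S v (rename r phi) <-> sat S (v \o r) phi.
Proof.
elim: phi W r v => {V}
  [V t u|V t u|V s args|V psi IH|V psi IH1 chi IH2|V psi IH] W r v /=.
- by rewrite !eval_rename.
- by rewrite !eval_rename.
- suff -> : (fun k => Defs.eval S v (rename_term r (args k))) =
            (fun k => Defs.eval S (v \o r) (args k)) by [].
  by apply/funext => k; exact: eval_rename.
- by rewrite IH.
- by rewrite IH1 IH2.
- have extE a : extend v a \o omap r = extend (v \o r) a.
    by apply/funext => -[].
  by split=> -[a]; [rewrite IH extE|rewrite -extE -IH]; exists a.
Qed.

Section Closure.
Context {V : Type}.
Implicit Types (P Q : (V -> M) -> Prop) (x y : V) (a : M).

Lemma definable_pred_iff P Q :
  (forall v, P v <-> Q v) -> definable_pred Q -> definable_pred P.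
Proof. by move=> PQ [phi Qphi]; exists phi => v; rewrite PQ. Qed.

Lemma definable_pred_not P :
  definable_pred P -> definable_pred (fun v => ~ P v).
Proof. by move=> [phi Pphi]; exists (FNot phi) => v /=; rewrite Pphi. Qed.

Lemma definable_pred_and P Q : definable_pred P -> definable_pred Q ->
  definable_pred (fun v => P v /\ Q v).
Proof.
move=> [phi Pphi] [psi Qpsi]; exists (FAnd phi psi) => v /=.
by rewrite Pphi Qpsi.
Qed.

Lemma definable_pred_or P Q : definable_pred P -> definable_pred Q ->
  definable_pred (fun v => P v \/ Q v).
Proof.
move=> dP dQ; apply: (@definable_pred_iff _ (fun v => ~ (~ P v /\ ~ Q v))).
  by move=> v; rewrite not_andP !notK.
by apply/definable_pred_not/definable_pred_and; exact: definable_pred_not.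
Qed.

Lemma definable_pred_imp P Q : definable_pred P -> definable_pred Q ->
  definable_pred (fun v => P v -> Q v).
Proof.
move=> dP dQ; apply: (@definable_pred_iff _ (fun v => ~ P v \/ Q v)).
  by move=> v; rewrite implyE.
by apply: definable_pred_or => //; exact: definable_pred_not.
Qed.

Lemma definable_pred_eqp x a : definable_pred (fun v => v x = a).
Proof. by exists (FEq (Var L M x) (Par L V a)). Qed.

Lemma definable_pred_ex (P : (V -> M) -> M -> Prop) :
  definable_pred (fun w : option V -> M => P (fun j => w (Some j)) (w None)) ->
  definable_pred (fun v => exists a, P v a).
Proof.
move=> [phi Pphi]; exists (FEx phi) => v /=.
by split=> -[a Pa]; exists a; apply/(Pphi (extend v a)).
Qed.

End Closure.

Section Quantifiers.
Context {V : Type}.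
Implicit Types (x y : V) (a : M).

Lemma definable_pred_all (P : (V -> M) -> M -> Prop) :
  definable_pred (fun w : option V -> M => P (fun j => w (Some j)) (w None)) ->
  definable_pred (fun v => forall a, P v a).
Proof.
move=> dP.
apply: (@definable_pred_iff _ _ (fun v => ~ exists a, ~ P v a)).
  move=> v; split=> [Pv [a]|nPv a]; first by apply; exact: Pv.
  by apply: contrapT => nPa; apply: nPv; exists a.
apply: definable_pred_not; apply: definable_pred_ex.
exact: definable_pred_not.
Qed.

Lemma definable_pred_lt x y : definable_pred (fun v => v x < v y).
Proof. by exists (FLt (Var L M x) (Var L M y)). Qed.

Lemma definable_pred_ltp x a : definable_pred (fun v => v x < a).
Proof. by exists (FLt (Var L M x) (Par L V a)). Qed.

Lemma definable_pred_plt a x : definable_pred (fun v => a < v x).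
Proof. by exists (FLt (Par L V a) (Var L M x)). Qed.

Lemma definable_pred_le x y : definable_pred (fun v => v x <= v y).
Proof.
apply: (@definable_pred_iff _ _ (fun v => ~ (v y < v x))).
  by move=> v; rewrite leNgt; split => /negP.
exact/definable_pred_not/definable_pred_lt.
Qed.

(** The syntax has no truth constant: the tautology is built from a variable, else from a parameter,
    else, [M] being empty, from a negated existential. *)
Lemma definable_pred_true : definable_pred (fun _ : V -> M => True).
Proof.
have [[x _]|noV] := pselect (exists x : V, True).
  apply: (@definable_pred_iff _ _ (fun v => v x <= v x)).
    by move=> v; split => // _; exact: lexx.
  exact: definable_pred_le.
have [[a _]|noM] := pselect (exists a : M, True).
  by exists (FEq (Par L V a) (Par L V a)).
exists (FNot (FEx (FEq (Var L M None) (Var L M None)))) => v /=.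
by split=> // _ [a _]; apply: noM; exists a.
Qed.

(** Writing the instance as [exists b, b = a /\ P v b] avoids substitution in formulas. It serves to
    define the fibres of definable relations. *)
Lemma definable_pred_par (P : (V -> M) -> M -> Prop) a :
  definable_pred (fun w : option V -> M => P (fun j => w (Some j)) (w None)) ->
  definable_pred (fun v => P v a).
Proof.
move=> dP.
apply: (@definable_pred_iff _ _ (fun v => exists b, b = a /\ P v b)).
  by move=> v; split=> [Pa|[b [->]]//]; exists a.
apply: definable_pred_ex; apply: definable_pred_and => //.
exact: definable_pred_eqp.
Qed.

Lemma definable_pred_rename (W : Type) (r : W -> V) (P : (W -> M) -> Prop) :
  definable_pred P -> definable_pred (fun v => P (v \o r)).
Proof.
by move=> [phi Pphi]; exists (rename r phi) => v; rewrite sat_rename Pphi.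
Qed.

Lemma definable_pred1 (X : set M) x :
  definable1 S X -> definable_pred (fun v => X (v x)).
Proof.
move=> [phi Xphi].
apply: (@definable_pred_rename 'I_1 (fun=> x) (fun v => X (v ord0))).
by exists phi => v; move/(congr1 (@^~ v)): Xphi => /= ->.
Qed.

Lemma definable_pred2 (Y : set (M * M)) x y :
  definable2 S Y -> definable_pred (fun v => Y (v x, v y)).
Proof.
move=> [phi Yphi].
apply: (@definable_pred_rename 'I_2 (fun i => if i == ord0 then x else y)
  (fun v => Y (v ord0, v ord_max))).
by exists phi => v; move/(congr1 (@^~ v)): Yphi => /= ->.
Qed.

Lemma definable_pred_itv (i : interval M) x :
  definable_pred (fun v => v x \in i).
Proof.
case: i => l u; apply: (@definable_pred_iff _ _
    (fun v => (l <= BLeft (v x)) /\ (BRight (v x) <= u))).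
  by move=> v; rewrite /in_mem /=; split => [/andP//|?]; exact/andP.
have cst (b : bool) : definable_pred (fun _ : V -> M => b).
  case: b; first exact: (definable_pred_iff _ definable_pred_true).
  apply: (definable_pred_iff _ (definable_pred_not definable_pred_true)).
  by move=> v; split => // /(_ I).
apply: definable_pred_and.
- case: l => [[] a|[]] /=; [|exact: definable_pred_plt|exact: cst|exact: cst].
  apply: (definable_pred_iff _ (definable_pred_not (definable_pred_ltp x a))).
  by move=> v; rewrite bnd_simp leNgt; split => /negP.
- case: u => [[] a|[]] /=; [exact: definable_pred_ltp| |exact: cst|exact: cst].
  apply: (definable_pred_iff _ (definable_pred_not (definable_pred_plt a x))).
  by move=> v; rewrite bnd_simp leNgt; split => /negP.
Qed.

End Quantifiers.

Lemma definable1P (X : set M) :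
  definable_pred (fun v : 'I_1 -> M => X (v ord0)) -> definable1 S X.
Proof. by move=> [phi Xphi]; exists phi; rewrite predeqE => v; exact: Xphi. Qed.

Lemma definable2P (Y : set (M * M)) :
  definable_pred (fun v : 'I_2 -> M => Y (v ord0, v ord_max)) -> definable2 S Y.
Proof. by move=> [phi Yphi]; exists phi; rewrite predeqE => v; exact: Yphi. Qed.

End Definability.

Ltac definability :=
  repeat first
    [ assumption
    | apply: definable_pred2; assumption
    | apply: definable_pred1; assumption
    | apply: definable_pred_not
    | apply: definable_pred_ex
    | apply: definable_pred_and
    | apply: definable_pred_or
    | apply: definable_pred_all
    | apply: definable_pred_imp
    | apply: definable_pred_lt
    | apply: definable_pred_le
    | apply: definable_pred_ltp
    | apply: definable_pred_plt
    | apply: definable_pred_itv ].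

(** * Suprema in the definable Dedekind completion *)

Section CompletionOrder.
Context {d : Order.disp_t} {M : orderType d} {L : language}.
Context (S : structure L M).
Implicit Types (A D : set M) (p : completion S).

Lemma Elt_le (a b : M) : (Elt S a <= Elt S b) = (a <= b).
Proof. by []. Qed.

Lemma Elt_lt (a b : M) : (Elt S a < Elt S b) = (a < b).
Proof. by rewrite !ltNge Elt_le. Qed.

(** A point of [M] is its own witness; for a gap, the upper part contains [z] and has no minimum. *)
Lemma lt_Elt_witness p (z : M) : p < Elt S z -> exists2 u, p <= Elt S u & u < z.
Proof.
case: p => [a|g]; first by rewrite Elt_lt => az; exists a.
move/ltW => /asboolP /gap_upper_nomin[u ug uz]; exists u => //.
exact/asboolP.
Qed.

(* Expresses comparisons of suprema in the completion by formulas over M. *)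
Lemma Elt_le_sup A p (z : M) : supremums (Elt S @` A) p ->
  Elt S z <= p <-> (forall w, w < z -> exists t, A t /\ w < t).
Proof.
move=> [ubp lubp]; split=> [zp w wz|zA].
  apply: contrapT => noA; move: wz; rewrite -Elt_lt; apply/negP; rewrite -leNgt.
  apply: (le_trans zp); apply: lubp => _ [t At <-]; rewrite Elt_le leNgt.
  by apply/negP => wt; apply: noA; exists t.
rewrite leNgt; apply/negP => /lt_Elt_witness[u pu /zA[t [At]]].
apply/negP; rewrite -leNgt -Elt_le; apply: le_trans pu.
by apply: ubp; exists t.
Qed.

Lemma sup_leP A B p q :
  supremums (Elt S @` A) p -> supremums (Elt S @` B) q ->
  p <= q <->
  (forall z, A z -> forall w, w < z -> exists t, B t /\ w < t).
Proof.
move=> supA supB; split=> [pq z Az|AB].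
  apply/(Elt_le_sup _ supB); apply: le_trans pq.
  by case: supA => ub _; apply: ub; exists z.
by case: supA => _; apply => _ [z Az <-]; apply/(Elt_le_sup _ supB)/AB.
Qed.

(** If [D] has no least upper bound in [M], its downward closure and the set of its strict upper
    bounds form a definable gap, which is the supremum. *)
Lemma definable_sup_ex (dloM : dlo_without_endpoints M) D (e : M) :
  definable1 S D -> D !=set0 -> ubound D e ->
  exists p, supremums (Elt S @` D) p.
Proof.
move=> defD [t0 Dt0] De; case: dloM => _ _ _ noub.
have [[m [Dm mD]]|nolub] := pselect (exists m, ubound D m /\
    (forall b, ubound D b -> m <= b)).
  exists (Elt S m); split => [_ [t Dt <-]|[b|h] ubq].
  - by rewrite Elt_le; exact: Dm.
  - by rewrite Elt_le; apply: mD => t Dt; rewrite -Elt_le; apply: ubq; exists t.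
  (* Otherwise [m] lies in the upper part of [h], which then contains some [b < m]; this [b] bounds
     [D], against the minimality of [m]. *)
  - apply/asboolP; apply: contrapT => nhm.
    have /gap_upper_nomin[b hb] : gap_upper h m by rewrite gap_upperE.
    apply/negP; rewrite -leNgt.
    apply: mD => t Dt; apply: ltW; apply: (gap_lt _ hb).
    by apply/asboolP; apply: (ubq (Elt S t)); exists t.
pose A : set M := [set w | exists t, D t /\ w <= t].
pose B : set M := [set w | forall t, D t -> t < w].
have defA : definable1 S A by apply: definable1P => /=; definability.
have defB : definable1 S B by apply: definable1P => /=; definability.
have A0 : A !=set0 by exists t0, t0.
have B0 : B !=set0.
  by have [e' ee'] := noub e; exists e' => t /De /le_lt_trans; apply.
have covAB : A `|` B = setT.
  apply/seteqP; split => // x _; apply: contrapT => /not_orP[nAx]; apply.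
  by move=> t Dt; rewrite ltNge; apply/negP => xt; apply: nAx; exists t.
have ltAB a b : A a -> B b -> a < b.
  by move=> [t [Dt at_]] /(_ t Dt); exact: le_lt_trans.
(* A maximum of [A] would be a maximum of [D], hence a least upper bound. *)
have Anomax a : A a -> exists2 a', A a' & a < a'.
  move=> [t [Dt at_]]; apply: contrapT => nomax; apply: nolub; exists t.
  split=> [s Ds|b]; last exact.
  rewrite leNgt; apply/negP => ts; apply: nomax; exists s.
    by exists s.
  exact: le_lt_trans ts.
(* As [D] has no maximum, every upper bound of [D] lies in [B]; a minimum of [B] would thus be a
   least upper bound. *)
have Bnomin b : B b -> exists2 b', B b' & b' < b.
  move=> Bb; apply: contrapT => nomin; apply: nolub; exists b.
  split=> [s /Bb/ltW//|b' Db']; rewrite leNgt; apply/negP => b'b.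
  apply: nomin; exists b' => // t Dt; rewrite lt_neqAle Db' // andbT.
  apply/eqP => tb'; have /Anomax[a [s [Ds as_]]] : A t by exists t.
  apply/negP; rewrite -leNgt tb'; apply: le_trans (Db' _ Ds); exact.
exists (GapPt (Gap defA defB A0 B0 covAB ltAB Anomax Bnomin)).
split => [_ [t Dt <-]|[b|h] ubq].
- by apply/asboolP; exists t.
- apply/asboolP => t Dt /=.
  have /Anomax[a [s [Ds as_]] ta] : A t by exists t.
  apply: (lt_le_trans ta); apply: (le_trans as_).
  by rewrite -Elt_le; apply: ubq; exists s.
- apply/asboolP => w [t [Dt wt]]; apply: (gap_lower_down wt).
  by apply/asboolP; apply: (ubq (Elt S t)); exists t.
Qed.

End CompletionOrder.

(** * Right germs of subsets of a linear order *)

Section RightGerms.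
Context {d : Order.disp_t} {M : orderType d}.
Implicit Types (X : set M) (x : M).

Definition right_germ X x := exists2 s, x < s & forall y, x < y -> y < s -> X y.

Lemma right_germI X Y x :
  right_germ X x -> right_germ Y x -> right_germ (X `&` Y) x.
Proof.
move=> [s xs sX] [t xt tY]; exists (Order.min s t); first by rewrite lt_min xs.
by move=> y xy; rewrite lt_min => /andP[ys yt]; split; [exact: sX|exact: tY].
Qed.

Lemma right_germS X Y x : X `<=` Y -> right_germ X x -> right_germ Y x.
Proof. by move=> XY [s xs sX]; exists s => // y xy /(sX y xy)/XY. Qed.

Definition right_decided X x := right_germ X x \/ right_germ (~` X) x.

(** Stability under unions reduces finite unions of points and intervals to a single interval. *)
Lemma right_decidedU X Y x :
  right_decided X x -> right_decided Y x -> right_decided (X `|` Y) x.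
Proof.
move=> [gX _|gX [gY|gY]].
- by left; apply: right_germS gX; exact: subsetUl.
- by left; apply: right_germS gY; exact: subsetUr.
- by right; rewrite setCU; exact: right_germI.
Qed.

End RightGerms.

Lemma itv_convex {d : Order.disp_t} {M : orderType d} (i : interval M) x y z :
  x \in i -> z \in i -> x <= y -> y <= z -> y \in i.
Proof.
case: i => l u /andP[lx _] /andP[_ zu] xy yz; apply/andP.
by split; [apply: le_trans lx _|apply: le_trans zu]; rewrite bnd_simp.
Qed.

(** * Local o-minimality for definable subsets of the line *)

Section OpenIntervals.
Context {d : Order.disp_t} {M : orderTopologicalType d} {L : language}.
Context (S : structure L M).
Context (dloM : dlo_without_endpoints M) (lominS : locally_o_minimal S).

(** An interval that meets every right neighbourhood of [x] contains one of them, by convexity. *)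
Lemma right_decided_itv (i : interval M) x : right_decided [set` i] x.
Proof.
have [[s xs si]|acc] := pselect (right_germ (~` [set` i]) x).
  by right; exists s.
have {acc}acc s : x < s -> exists y, [/\ x < y, y < s & y \in i].
  move=> xs; apply: contrapT => noy; apply: acc; exists s => // y xy ys iy.
  by apply: noy; exists y.
left; case: dloM => _ _ _ /(_ x)[s0 /acc[s [xs _ si]]].
exists s => // y xy ys; have [z [xz zy zi]] := acc y xy.
exact: (itv_convex zi si (ltW zy) (ltW ys)).
Qed.

Lemma itv_open_endsP (i : interval M) x : itv_open_ends i -> x \in i ->
  exists a b, [/\ a < x, x < b & forall y, a < y -> y < b -> y \in i].
Proof.
case: dloM => _ _ noleft noright; have [a0 a0x] := noleft x.
have [b0 xb0] := noright x.
case: i => [[[] a|[]] [[] b|[]]] //= _; rewrite in_itv /= ?andbT.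
- move=> /andP[ax xb]; exists a, b; split=> // y ay yb.
  by rewrite in_itv /= ay.
- by move=> ax; exists a, b0; split=> // y ay yb; rewrite in_itv /= ay.
- by move=> xb; exists a0, b; split=> // y ay yb; rewrite in_itv /= yb.
- by move=> _; exists a0, b0; split=> // y ay yb; rewrite in_itv.
Qed.

Lemma nbhs_ooP x (U : set M) : nbhs x U ->
  exists a b, [/\ a < x, x < b & forall y, a < y -> y < b -> U y].
Proof.
rewrite itv_nbhsE => -[i [oi xi] iU].
have [a [b [ax xb abi]]] := itv_open_endsP oi xi.
by exists a, b; split => // y ay yb; apply/iU/abi.
Qed.

Lemma nbhs_oo (a b x : M) : a < x -> x < b -> nbhs x `]a, b[%classic.
Proof.
move=> ax xb; rewrite itv_nbhsE; exists (`]a, b[%O) => //.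
by split; [exact: orbT|rewrite in_itv /= ax].
Qed.

(** Near [x] the set is a finite union of points and intervals, each of which is decided on the
    right of [x]. *)
Lemma definable_right_decided (X : set M) x :
  definable1 S X -> right_decided X x.
Proof.
move=> /lominS-/(_ x)[i [oi xi [F [s [/finite_seqP[e ->] _ XiE]]]]].
have [a [b [ax xb abi]]] := itv_open_endsP oi xi.
have gi : right_germ [set` i] x by exists b => // y /(lt_trans ax); exact: abi.
suff [gXi|gXi] : right_decided (X `&` [set` i]) x.
- by left; apply: right_germS gXi; exact: subIsetl.
- right; apply: right_germS (right_germI gXi gi) => y [nXi yi] Xy.
  exact: nXi.
rewrite XiE; apply: right_decidedU.
- elim: e {XiE} => [|c e IH].
    by right; exists b => // y _ _ /=; rewrite in_nil.
  have -> : [set` c :: e] = [set c] `|` [set` e].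
    apply/seteqP; split => y /=; rewrite in_cons; first by move=> /predU1P.
    by move=> /predU1P.
  apply: right_decidedU => //.
  rewrite -set_itv1; exact: right_decided_itv.
- apply: (big_ind (right_decided^~ x)) => [|Y Z|j _].
  + by right; exists b => // y _ _ [].
  + exact: right_decidedU.
  + exact: right_decided_itv.
Qed.

(** The open intervals in the local description of [X] must be empty, so [X] is locally finite;
    finite sets are closed in the order topology. *)
Lemma definable_interior0 (X : set M) : definable1 S X ->
  (forall a b, a < b -> exists y, [/\ a < y, y < b & ~ X y]) ->
  discrete X /\ closed X.
Proof.
move=> defX X0.
have finX x : exists i : interval M,
    [/\ itv_open_ends i, x \in i & finite_set (X `&` [set` i])].
  have [i [oi xi [F [s [finF /allP os XiE]]]]] := lominS x defX.
  exists i; split => //; rewrite XiE big_seq big1 ?setU0// => j js.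
  rewrite -subset0 => z zj.
  have [a [b [az zb abj]]] := itv_open_endsP (os j js) zj.
  have [y [ay yb nXy]] := X0 a b (lt_trans az zb).
  have : (F `|` \big[setU/set0]_(k <- s) [set` k]) y.
    by right; rewrite -bigcup_seq; exists j => //; exact: abj.
  by rewrite -XiE => -[].
have cl : forall A : set M, finite_set A -> closed A.
  exact/accessible_finite_set_closed/hausdorff_accessible/order_hausdorff.
split.
- move=> x Xx; split; first exact/mem_set.
  have [i [oi xi fini]] := finX x.
  (* This neighbourhood of [x] removes from [i] the finitely many other points of [X]. *)
  exists ([set` i] `&` ~` ((X `&` [set` i]) `\ x)).
    apply: open_nbhs_nbhs; split; last by split => // -[_]; apply.
    apply: openI; first exact: itv_open_ends_open.
    by rewrite openC; apply: cl; exact: finite_setD.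
  apply/seteqP; split => [y [[iy nXy] Xy]|_ ->]; last first.
    by split => //; split => // -[_]; apply.
  by apply: contrapT => yx; apply: nXy.
- rewrite -openC openE => x nXx; have [i [oi xi fini]] := finX x.
  apply: (@filterS _ _ _ ([set` i] `&` ~` (X `&` [set` i]))).
    by move=> y [iy nXi] Xy; exact: nXi.
  apply: open_nbhs_nbhs; split; last by split => // -[].
  apply: openI; first exact: itv_open_ends_open.
  by rewrite openC; exact: cl.
Qed.

End OpenIntervals.

(** * From right germs to uniformity on an interval *)

Section Uniformization.
Context {d : Order.disp_t} {M : orderTopologicalType d} {L : language}.
Context (S : structure L M).
Context (dloM : dlo_without_endpoints M) (lominS : locally_o_minimal S).

Section InitialSegments.
Context (T : set (M * M)) (a b : M).
Context (germT : forall x, a < x -> x < b -> right_germ [set y | T (x, y)] x).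

(** The fibre over [x] consists of the [y < b] with []x, y]] inside the fibre of [T]. It is an
    initial segment to the right of [x], so one large element, or the supremum, controls all smaller
    ones; the bound [b] ensures that the supremum exists. *)
Definition initial_segments : set (M * M) :=
  [set p | a < p.1 /\ p.1 < p.2 /\ p.2 < b /\
           forall z, p.1 < z -> z <= p.2 -> T (p.1, z)].

Lemma definable_initial_segments :
  definable2 S T -> definable2 S initial_segments.
Proof. by move=> defT; apply: definable2P => /=; definability. Qed.

Lemma initial_segments_germ x : a < x -> x < b ->
  right_germ [set y | initial_segments (x, y)] x.
Proof.
move=> ax xb; have [s xs sT] := germT ax xb.
exists (Order.min s b); first by rewrite lt_min xs.
move=> y xy; rewrite lt_min => /andP[ys yb]; do 3!split => //.
by move=> z xz zy; apply: sT => //; exact: le_lt_trans ys.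
Qed.

Lemma right_germ_ex (X : set M) x : right_germ X x -> exists2 y, x < y & X y.
Proof.
move=> [s xs sX]; case: dloM => _ dense _ _.
by have [y /andP[xy ys]] := dense _ _ xs; exists y => //; exact: sX.
Qed.

Lemma fst_initial_segments : fst @` initial_segments = `]a, b[%classic.
Proof.
apply/seteqP; split => [_ [[x y] [/= ax [xy [yb _]]] <-]|x /=].
  by rewrite /= in_itv /= ax (lt_trans xy yb).
rewrite in_itv /= => /andP[ax xb].
by have [y _ Ty] := right_germ_ex (initial_segments_germ ax xb); exists (x, y).
Qed.

(** The right germs already give interior to every fibre, and the projection is []a, b[]. *)
Lemma initial_segments_wild : a < b -> interior initial_segments = set0 ->
  dimensionally_wild initial_segments.
Proof.
move=> ab int0; split => //.
  rewrite fst_initial_segments; case: dloM => _ dense _ _.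
  have [x /andP[ax xb]] := dense _ _ ab; exists x.
  exact: nbhs_oo.
move=> x; rewrite fst_initial_segments /= in_itv /= => /andP[ax xb].
have [s xs sT] := initial_segments_germ ax xb; case: dloM => _ dense _ _.
have [y /andP[xy ys]] := dense _ _ xs; exists y.
apply: filterS (nbhs_oo xy ys) => z /=; rewrite in_itv /= => /andP[xz zs].
exact: sT.
Qed.

Lemma initial_segments_box : interior initial_segments !=set0 ->
  exists a' b' y, [/\ a' < b', b' <= y &
    forall x, a' < x -> x < b' -> initial_segments (x, y)].
Proof.
move=> [[x y] xyT]; have [_ [/= xy _]] := interior_subset xyT.
case: xyT => -[/= U V] [xU yV] UVT.
have [a' [b' [ax xb abU]]] := nbhs_ooP dloM xU.
(* The base of the box is cut at [y], so that all of it lies below the common height [y]. *)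
exists a', (Order.min b' y), y; split.
- by rewrite lt_min (lt_trans ax xb) (lt_trans ax xy).
- by rewrite ge_min lexx orbT.
- move=> z az; rewrite lt_min => /andP[zb _]; apply: (UVT (z, y)); split => /=.
    exact: abU.
  exact: nbhs_singleton.
Qed.

Lemma initial_segments_sup : definable2 S T -> a < b ->
  exists f : M -> completion S, definable_fun `]a, b[%classic f /\
    forall x, a < x -> x < b ->
      supremums (Elt S @` [set y | initial_segments (x, y)]) (f x).
Proof.
move=> /definable_initial_segments defT ab.
have supT x : exists p : completion S, a < x -> x < b ->
    supremums (Elt S @` [set y | initial_segments (x, y)]) p.
  have [/andP[ax xb]|nx] := pselect (a < x < b); last first.
    (* Outside []a, b[] any value will do; [Elt S x] is a placeholder. *)
    by exists (Elt S x) => ax xb; case: nx; rewrite ax.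
  have [|||p supp] :=
    @definable_sup_ex _ _ _ S dloM [set y | initial_segments (x, y)] b.
  - apply: definable1P => /=.
    apply: (definable_pred_par (P := fun v c => initial_segments (c, v ord0))).
    by definability.
  - by have [y _ Ty] := right_germ_ex (initial_segments_germ ax xb); exists y.
  - by move=> y [_ [_ [/= yb _]]]; exact: ltW.
  by exists p.
have [f fP] := choice supT; exists f; split => //.
split; first by apply: definable1P => /=; definability.
exists initial_segments; split => //; first exact: fst_initial_segments.
by move=> x; rewrite /= in_itv /= => /andP[]; exact: fP.
Qed.

End InitialSegments.

Definition uniform_on (T : set (M * M)) (a b : M) : Prop :=
  forall x y, a < x -> x < y -> y < b -> T (x, y).

(** The first hypothesis negates alternative (1) of the theorem. Without wild sets the initial
    segments contain a box; with *-continuity their supremum stays above a constant near some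
    point. *)
Lemma uniform_right_germs (T : set (M * M)) (a b : M) :
  univariate_star_continuity S \/
    ~ (exists X : set (M * M), definable2 S X /\ dimensionally_wild X) ->
  definable2 S T -> a < b ->
  (forall x, a < x -> x < b -> right_germ [set y | T (x, y)] x) ->
  exists a' b', [/\ a <= a', a' < b', b' <= b & uniform_on T a' b'].
Proof.
move=> tame defT ab germT; case: tame => [starc|nowild]; last first.
  have [int0|/set0P/initial_segments_box[a' [b' [y [ab' by_ boxT]]]]] :=
      eqVneq (interior (initial_segments T a b)) set0.
    case: nowild; exists (initial_segments T a b).
    split; first exact: definable_initial_segments.
    exact: initial_segments_wild.
  have a'P x : a' < x -> x < b' -> a < x < b.
    move=> ax xb; have [/= -> [xy [yb _]]] := boxT x ax xb.
    exact: lt_trans yb.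
  exists a', b'; split => //.
  (* A point between [a'] and both [a] and [b'] would lie in the base of the box, hence above
     [a]. *)
  - rewrite leNgt; apply/negP => a'a; case: dloM => _ dense _ _.
    have [x /andP[a'x]] : exists x, a' < x < Order.min a b'.
      by apply: dense; rewrite lt_min a'a.
    rewrite lt_min => /andP[xa xb']; have /andP[ax _] := a'P _ a'x xb'.
    by have := lt_trans ax xa; rewrite ltxx.
  - case: dloM => _ dense _ _; have [x /andP[a'x xb']] := dense _ _ ab'.
    have [_ [_ [/= yb _]]] := boxT x a'x xb'.
    exact: le_trans by_ (ltW yb).
  - move=> x z ax xz zb; have [_ [/= _ [_ Txz]]] := boxT x ax (lt_trans xz zb).
    by apply: Txz => //; exact: le_trans (ltW zb) by_.
have [f [deff supf]] := initial_segments_sup germT defT ab.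
have [||j [oj [x0 jx0] jab cf]] := starc `]a, b[%O f _ _ deff.
- exact: orbT.
- case: dloM => _ dense _ _; have [x /andP[ax xb]] := dense _ _ ab.
  by exists x; rewrite /= in_itv /= ax.
have /andP[ax0 x0b] : a < x0 < b by have := jab _ jx0; rewrite /= in_itv.
(* The fibre over [x0] contains some [y > x0]; any [c] strictly between them satisfies
   [x0 < c < f x0]. *)
have [y x0y Ty] := right_germ_ex (initial_segments_germ germT ax0 x0b).
case: (dloM) => _ dense _ _; have [c /andP[x0c cy]] := dense _ _ x0y.
have cfx0 : Elt S c < f x0.
  apply: (@lt_le_trans _ _ (Elt S y)); first by rewrite Elt_lt.
  by have [ub _] := supf _ ax0 x0b; apply: ub; exists y.
rewrite continuous_open_subspace in cf; last exact: itv_open_ends_open.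
have nf : nbhs x0 (f @^-1` `]Elt S c, +oo[%classic).
  apply: (cf x0); first exact/mem_set.
  apply: open_nbhs_nbhs; split; first exact: rray_open.
  by rewrite /= in_itv /= cfx0.
have nj : nbhs x0 [set` j].
  by apply: open_nbhs_nbhs; split => //; exact: itv_open_ends_open.
have [a' [b' [a'x0 x0b' a'b'P]]] := nbhs_ooP dloM (filterI nf nj).
have a'bP x : a' < x -> x < b' -> [/\ a < x, x < b & Elt S c < f x].
  move=> ax xb; have [] := a'b'P x ax xb.
  rewrite /= in_itv /= andbT => cfx /jab.
  by rewrite /= in_itv /= => /andP[].
(* The cuts at [a'] and [b'] keep [f] above [c], and the cut at [c] keeps second coordinates below
   [f x]. *)
exists (Order.max a a'), (Order.min b (Order.min b' c)); split.
- by rewrite le_max lexx.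
- by apply: (@lt_trans _ _ x0); rewrite ?gt_max ?lt_min ?ax0 ?a'x0 ?x0b ?x0b'.
- by rewrite ge_min lexx.
- move=> x z; rewrite gt_max !lt_min => /andP[ax a'x] xz /and3P[zb zb' zc].
  have [_ _ cfx] := a'bP x a'x (lt_trans xz zb').
  (* If [T] failed at [(x, z)], every initial segment at [x] would stop before [z], whence
     [f x <= z < c]. *)
  apply: contrapT => nTxz; move: cfx; apply/negP; rewrite -leNgt.
  have [_ lub] := supf x ax (lt_trans xz zb).
  apply: (@le_trans _ _ (Elt S z)); last by rewrite Elt_le ltW.
  apply: lub => _ [w [_ [/= xw [_ Txw]]] <-]; rewrite Elt_le leNgt.
  by apply/negP => zw; apply: nTxz; apply: Txw => //; exact: ltW.
Qed.

(** Having a right germ inside the fibre of [T] is a definable condition on the point, so it is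
    constant just to the right of [x0]. There either [T] or its complement has right germs at all
    points. *)
Lemma ramsey_interval (T : set (M * M)) (a b : M) :
  univariate_star_continuity S \/
    ~ (exists X : set (M * M), definable2 S X /\ dimensionally_wild X) ->
  definable2 S T -> a < b ->
  exists a' b', [/\ a <= a', a' < b', b' <= b &
    uniform_on T a' b' \/ uniform_on (~` T) a' b'].
Proof.
move=> tame defT ab; case: (dloM) => _ dense _ _.
have defnT : definable2 S (~` T) by apply: definable2P => /=; definability.
(* The right germ condition is spelled out with a conjunction, a form that [definability] can
   decompose. *)
pose G : set M :=
  [set x | exists s, x < s /\ forall y, x < y -> y < s -> T (x, y)].
have defG : definable1 S G by apply: definable1P => /=; definability.
have [x0 /andP[ax0 x0b]] := dense _ _ ab.
have subU T' s : definable2 S T' -> x0 < s ->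
    (forall x, x0 < x -> x < s -> right_germ [set y | T' (x, y)] x) ->
    exists a' b', [/\ a <= a', a' < b', b' <= b & uniform_on T' a' b'].
  move=> defT' x0s germT'.
  have [||a' [b' [xa' ab' bs uT]]] :=
      @uniform_right_germs T' x0 (Order.min s b) tame defT'.
  - by rewrite lt_min x0s.
  - by move=> x xx0; rewrite lt_min => /andP[xs _]; exact: germT'.
  exists a', b'; split => //; first exact: le_trans (ltW ax0) xa'.
  by apply: le_trans bs _; rewrite ge_min lexx orbT.
have [[s x0s sG]|[s x0s sG]] :=
    definable_right_decided dloM lominS x0 defG.
- have [|a' [b' [? ? ? ?]]] := subU T s defT x0s.
    by move=> x x0x /(sG _ x0x)[t [xt tT]]; exists t.
  by exists a', b'; split => //; left.
- have [|a' [b' [? ? ? ?]]] := subU (~` T) s defnT x0s.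
    move=> x x0x /(sG _ x0x) nGx.
    (* The fibre is decided on the right of [x], so outside [G] its complement has the right
       germ. *)
    have : right_decided [set y | T (x, y)] x.
      apply: (definable_right_decided dloM lominS); apply: definable1P => /=.
      apply: (definable_pred_par (P := fun v c => T (c, v ord0))).
      by definability.
    by move=> [[t xt tT]|//]; case: nGx; exists t.
  by exists a', b'; split => //; right.
Qed.

(** * Points around which a relation holds uniformly *)

Section LocalBehaviour.
Context (i : interval M).

Definition locally_uniform (T : set (M * M)) : set M :=
  [set x | exists a, a < x /\ exists b, x < b /\
    (forall y, a < y -> y < b -> y \in i) /\
    (forall y z, a < y -> y < z -> z < b -> T (y, z))].

Lemma definable_locally_uniform (T : set (M * M)) :
  definable2 S T -> definable1 S (locally_uniform T).
Proof. by move=> defT; apply: definable1P => /=; definability. Qed.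

Lemma open_locally_uniform (T : set (M * M)) : open (locally_uniform T).
Proof.
rewrite openE => x [a [ax [b [xb abT]]]].
apply: filterS (nbhs_oo ax xb) => y; rewrite /= in_itv /= => /andP[ay yb].
by exists a; split => //; exists b.
Qed.

Lemma locally_uniformS (T : set (M * M)) : locally_uniform T `<=` [set` i].
Proof. by move=> x [a [ax [b [xb [abi _]]]]]; exact: abi. Qed.

(** By density, a common point [x] has some [y > x] so close that [(x, y)] lies in both
    relations. *)
Lemma disjoint_locally_uniform (T U : set (M * M)) : T `&` U = set0 ->
  locally_uniform T `&` locally_uniform U = set0.
Proof.
move=> TU; rewrite -subset0 => x.
move=> [[a [ax [b [xb [_ abT]]]]] [a' [a'x [b' [xb' [_ abU]]]]]].
case: (dloM) => _ dense _ _.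
have [y /andP[xy]] : exists y, x < y < Order.min b b'.
  by apply: dense; rewrite lt_min xb.
rewrite lt_min => /andP[yb yb'].
have : (T `&` U) (x, y) by split; [exact: abT|exact: abU].
by rewrite TU.
Qed.

Lemma locally_on_locally_uniform (T : set (M * M)) (P : set M -> Prop) :
  (forall A : set M, (forall y z, A y -> A z -> y < z -> T (y, z)) -> P A) ->
  locally_on P (locally_uniform T).
Proof.
move=> TP x [a [ax [b [xb [abi abT]]]]]; exists `]a, b[%O; split.
- exact: orbT.
- by rewrite in_itv /= ax.
- move=> y; rewrite /= in_itv /= => /andP[ay yb].
  by exists a; split => //; exists b.
- apply: TP => y z; rewrite /= !in_itv /= => /andP[ay _] /andP[_ zb] yz.
  exact: abT.
Qed.

(** The values of [f] lie outside [M]; [sup_leP] replaces their comparison by one between the fibres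
    of [Y]. *)
Lemma definable_fun_le (f : M -> completion S) : definable_fun [set` i] f ->
  definable2 S [set p | p.1 \in i /\ p.2 \in i /\ f p.1 <= f p.2].
Proof.
move=> [_ [Y [defY _ supY]]]; apply: definable2P.
apply: (definable_pred_iff (Q := fun v : 'I_2 -> M =>
  v ord0 \in i /\ v ord_max \in i /\
  (forall z, Y (v ord0, z) ->
     forall w, w < z -> exists t, Y (v ord_max, t) /\ w < t))).
  by move=> v /=; split=> -[xi [yi fxy]]; do 2!split => //;
    apply/(sup_leP (supY _ xi) (supY _ yi)).
by definability.
Qed.

End LocalBehaviour.

End Uniformization.

(** * Assembly of the decomposition *)

Theorem theorem3p17 (d : Order.disp_t) (M : orderTopologicalType d)
    (L : language) (S : structure L M)
    (dloM : dlo_without_endpoints M) (lominS : locally_o_minimal S) :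
  (~ univariate_star_continuity S /\
   exists X : set (M * M), definable2 S X /\ dimensionally_wild X)
  \/
  (forall (i : interval M) (f : M -> completion S),
     itv_open_ends i -> definable_fun [set` i] f ->
     exists Xp Xm Xc Xd : set M,
       locally_monotone_decomposition [set` i] f Xp Xm Xc Xd).
Proof.
set wild := exists X, _.
have [[nstar hwild]|] := pselect (~ univariate_star_continuity S /\ wild).
  by left.
move=> /not_andP; rewrite notK => tame; right => i f oi deff.
have defle := definable_fun_le deff.
have defi : definable1 S [set` i] by apply: definable1P => /=; definability.
(* Membership in [i] is built in, as [f] is controlled only there. For two points of [i], exactly
   one of [inc], [dec], [con] holds, since the completion is totally ordered. *)
pose le_f := [set p : M * M | p.1 \in i /\ p.2 \in i /\ f p.1 <= f p.2].
pose ge_f := [set p : M * M | le_f (p.2, p.1)].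
pose inc := le_f `\` ge_f.
pose dec := ge_f `\` le_f.
pose con := le_f `&` ge_f.
have defle_f : definable2 S le_f by [].
have defge_f : definable2 S ge_f.
  by apply: definable2P; exact: (definable_pred2 ord_max ord0 defle_f).
have definc : definable2 S inc by apply: definable2P => /=; definability.
have defdec : definable2 S dec by apply: definable2P => /=; definability.
have defcon : definable2 S con by apply: definable2P => /=; definability.
pose Xp := locally_uniform i inc.
pose Xm := locally_uniform i dec.
pose Xc := locally_uniform i con.
have defXp : definable1 S Xp by exact: definable_locally_uniform.
have defXm : definable1 S Xm by exact: definable_locally_uniform.
have defXc : definable1 S Xc by exact: definable_locally_uniform.
pose Xd := [set x | x \in i /\ ~ (Xp x \/ Xm x \/ Xc x)].
have defXd : definable1 S Xd by apply: definable1P => /=; definability.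
have Xd0 a b : a < b -> exists y, [/\ a < y, y < b & ~ Xd y].
  move=> ab; case: (dloM) => _ dense _ _; apply: contrapT => noy.
  have abXd y : a < y -> y < b -> Xd y.
    by move=> ay yb; apply: contrapT => nXd; apply: noy; exists y.
  (* Three nested applications give an interval on which each relation holds for all ordered pairs
     or for none. *)
  have [a1 [b1 [aa1 ab1 bb1 u1]]] :=
    ramsey_interval dloM lominS tame definc ab.
  have [a2 [b2 [aa2 ab2 bb2 u2]]] :=
    ramsey_interval dloM lominS tame defdec ab1.
  have [a3 [b3 [aa3 ab3 bb3 u3]]] :=
    ramsey_interval dloM lominS tame defcon ab2.
  have a1y y : a3 < y -> a1 < y by apply: le_lt_trans; exact: le_trans aa3.
  have yb1 y : y < b3 -> y < b1.
    by move=> yb; apply: lt_le_trans yb _; exact: le_trans bb2.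
  (* Being in [Xd] by assumption, the points of the small interval belong to [i]. *)
  have abi y : a3 < y -> y < b3 -> y \in i.
    move=> ay yb; have [//] : Xd y.
    apply: abXd; first exact: le_lt_trans aa1 (a1y _ ay).
    exact: lt_le_trans (yb1 _ yb) bb1.
  have [x /andP[ax xb]] := dense _ _ ab3.
  have [_] : Xd x.
    apply: abXd; first exact: le_lt_trans aa1 (a1y _ ax).
    exact: lt_le_trans (yb1 _ xb) bb1.
  apply.
  case: u1 => [u1|n1].
    left; exists a3; split=> //; exists b3; split=> //; split=> //.
    by move=> y z ay yz zb; apply: u1 => //; [exact: a1y|exact: yb1].
  right; case: u2 => [u2|n2].
    left; exists a3; split=> //; exists b3; split=> //; split=> //.
    move=> y z ay yz zb; apply: u2 => //; [exact: le_lt_trans ay|].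
    exact: lt_le_trans zb _.
  right; case: u3 => [u3|n3]; exists a3; split=> //; exists b3; split=> //;
    split=> // y z ay yz zb.
  (* If all three relations failed on the interval, two values of [f] would be incomparable. *)
  exfalso; have yi : y \in i by apply: abi => //; exact: lt_trans zb.
  have zi : z \in i by apply: abi => //; exact: lt_trans yz.
  have le_ge : le_f (y, z) \/ ge_f (y, z).
    by have /orP[fyz|fzy] := le_total (f y) (f z); [left|right].
  have nI : ~ inc (y, z) by apply: n1 => //; [exact: a1y|exact: yb1].
  have nD : ~ dec (y, z).
    apply: n2 => //; first exact: le_lt_trans ay.
    exact: lt_le_trans zb _.
  have nC : ~ con (y, z) by exact: n3.
  have [lyz|nlyz] := pselect (le_f (y, z)).
    by have [gyz|ngyz] := pselect (ge_f (y, z)); [apply: nC|apply: nI].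
  by case: le_ge => // gyz; apply: nD.
exists Xp, Xm, Xc, Xd; split => //.
- apply/seteqP; split => x.
    by move=> [[[|]|]|[]//]; exact: locally_uniformS.
  move=> xi; have [|nX] := pselect (Xp x \/ Xm x \/ Xc x).
    by move=> [|[|]] ?; left; [left; left|left; right|right].
  by right.
- have dj T : ~ (T `&` Xd !=set0) -> T `&` Xd = set0.
    by move/set0P/negP; rewrite negbK => /eqP.
  split; split.
  + apply: disjoint_locally_uniform => //; rewrite -subset0.
    by move=> p [[? ?] [? ?]].
  + apply: disjoint_locally_uniform => //; rewrite -subset0.
    by move=> p [[? ?] [? ?]].
  + by apply: dj => -[x [Xx [_]]]; apply; left.
  + apply: disjoint_locally_uniform => //; rewrite -subset0.
    by move=> p [[? ?] [? ?]].
  + by apply: dj => -[x [Xx [_]]]; apply; right; left.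
  + by apply: dj => -[x [Xx [_]]]; apply; right; right.
- split.
  + exact: (definable_interior0 dloM lominS defXd).
  + split; first exact: open_locally_uniform.
    apply: locally_on_locally_uniform => A AT y z Ay Az.
    (* The relation [con] is known only for ordered pairs; the other pairs follow by symmetry. *)
    have eqT u v : A u -> A v -> u < v -> f u = f v.
      move=> Au Av /(AT u v Au Av)[[_ [_ fuv]] [_ [_ fvu]]].
      by apply/le_anti; rewrite fuv.
    have [yz|zy|-> //] := ltgtP y z; first exact: eqT.
    exact/esym/eqT.
  + split; first exact: open_locally_uniform.
    apply: locally_on_locally_uniform => A AT y z Ay Az.
    move=> /(AT y z Ay Az)[[zi [yi fzy]] nle].
    by rewrite ltNge; apply/negP => fyz; apply: nle.
  + split; first exact: open_locally_uniform.
    apply: locally_on_locally_uniform => A AT y z Ay Az.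
    move=> /(AT y z Ay Az)[[yi [zi fyz]] nle].
    by rewrite ltNge; apply/negP => fzy; apply: nle.
Qed.
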